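(* Let $\Omega$ be a nonempty finite set and let $s:\mathcal C\to[0,\infty]^\Omega$ be a scoring rule that is strictly proper and continuous on probabilities. Then for every $c\in\mathcal C\setminus\mathcal P$ there is a probability $p\in\mathcal P$ such that $s(p)(\omega)<s(c)(\omega)$ for all $\omega\in\Omega$.
   Context: $\Omega=\{\omega_1,\dots,\omega_n\}$ is a nonempty finite set with $n$ elements. $\mathcal C$ is the set of all functions from the power set of $\Omega$ to $\mathbb R$ (credence functions). $\mathcal P\subseteq\mathcal C$ is the set of those functions that satisfy the axioms of (finitely additive) probability. A scoring rule is a function $s:\mathcal C\to[0,\infty]^\Omega$; so for $c\in\mathcal C$, $s(c)$ is a function from $\Omega$ to $[0,\infty]$. For $p\in\mathcal P$ and $f:\Omega\to[0,\infty]$, define $$E_p f=\sum_{\omega\in\Omega,\ p(\{\omega\})\neq 0}p(\{\omega\})f(\omega)\in[0,\infty].$$ A scoring rule $s$ is proper if $E_p s(p)\le E_p s(c)$ for all $p\in\mathcal P$ and $c\in\mathcal C$. It is strictly proper if $E_p s(p)<E_p s(c)$ for all $p\in\mathcal P$ and all $c\in\mathcal C$ with $c\neq p$. Let $T$ be the set of $v=(v_1,\dots,v_n)\in\mathbb R^n$ with $v_i\ge 0$ for all $i$ and $\sum_i v_i=1$. For $v\in T$ let $p_v\in\mathcal P$ be the probability with $p_v(\{\omega_i\})=v_i$ for all $i$. The scoring rule $s$ is continuous on probabilities if $\hat s(v)=s(p_v)$ is a continuous function from $T$ to $[0,\infty]^\Omega$, where $[0,\infty]^\Omega$ has the product topology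 (with the usual topology on $[0,\infty]$). *)

(* Defs.v *)
From HB Require Import structures.
From mathcomp Require Import all_boot all_order all_algebra.
From mathcomp Require Import all_classical all_reals all_analysis.

Set Implicit Arguments.
Unset Strict Implicit.
Unset Printing Implicit Defensive.

Import Order.TTheory GRing.Theory Num.Theory.
Import numFieldNormedType.Exports.

Local Open Scope classical_set_scope.
Local Open Scope ring_scope.

Section Credences.
Variables (R : realType) (Omega : finType).

Definition credence := {set Omega} -> R.

Definition is_probability (p : credence) : Prop :=
  [/\ forall A : {set Omega}, 0 <= p A,
      p [set: Omega]%SET = 1
    & forall A B : {set Omega},
        (A :&: B)%SET = finset.set0 -> p (A :|: B)%SET = p A + p B].

(* The interval [0, +oo] is encoded as the nonnegative part of \bar R. *)
Definition is_scoring_rule (s : credence -> Omega -> \bar R) : Prop :=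
  forall c w, (0 <= s c w)%E.

Definition expect (p : credence) (f : Omega -> \bar R) : \bar R :=
  (\sum_(w : Omega | p [set w]%SET != 0%R) (p [set w]%SET)%:E * f w)%E.

Definition strictly_proper (s : credence -> Omega -> \bar R) : Prop :=
  forall p c : credence, is_probability p -> c <> p ->
    (expect p (s p) < expect p (s c))%E.

Definition simplex : set 'rV[R]_#|Omega| :=
  [set v | (forall i, 0 <= v 0 i) /\ \sum_i v 0 i = 1].

(* The points of Omega are numbered by enum_val : 'I_#|Omega| -> Omega, whose
   inverse is enum_rank. For v in the simplex, this is the only probability
   with value v 0 i at [set enum_val i]: see prob_ofP below. *)
Definition prob_of (v : 'rV[R]_#|Omega|) : credence :=
  fun A => \sum_(w in A) v 0 (enum_rank w).

(* The codomain carries the product topology; continuity into [0, +oo] and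
   into \bar R agree, the topology of the former being the induced one. *)
Definition continuous_on_probabilities (s : credence -> Omega -> \bar R) :
    Prop :=
  {within simplex, continuous
    (fun v => s (prob_of v) : prod_topology (fun _ : Omega => \bar R))}.

Lemma prob_ofP (v : 'rV[R]_#|Omega|) (p : credence) : simplex v ->
  (is_probability p /\ forall i, p [set enum_val i]%SET = v 0 i) <->
  p = prob_of v.
Proof.
move=> [v0 v1]; split=> [[[p0 p1 pU] pv]|->].
  have pset0 : p finset.set0 = 0.
    have := pU finset.set0 finset.set0; rewrite finset.setU0.
    rewrite finset.setI0 => /(_ erefl)/eqP.
    by rewrite -subr_eq0 opprD addrA subrr sub0r oppr_eq0 => /eqP.
  apply/funext => A; rewrite /prob_of.
  elim: {A}#|A| {-2}A (erefl #|A|) => [|k IH] A.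
    by move/cards0_eq => ->; rewrite pset0 big_set0.
  move=> cA; have /card_gt0P[w wA] : (0 < #|A|)%N by rewrite cA.
  rewrite (big_setD1 w)//= -IH; last first.
    by apply/eqP; rewrite -eqSS -cA (cardsD1 w A) wA.
  rewrite -pv enum_rankK -pU ?finset.setD1K//.
  by apply/finset.setP => x; rewrite !inE; case: eqP.
split; first split.
- by move=> A; apply: sumr_ge0.
- rewrite -v1 (reindex enum_rank) /=; last exact/onW_bij/enum_rank_bij.
  by apply: eq_bigl => w; rewrite inE.
- move=> A B AB; rewrite /prob_of (big_setID A)/= finset.setUK finset.setDUl.
  rewrite finset.setDv finset.set0U; congr (_ + _); apply: eq_bigl => w.
  have /finset.setP/(_ w) := AB; rewrite !inE.
  by case: (w \in A); case: (w \in B).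
- by move=> i; rewrite /prob_of big_set1 enum_valK.
Qed.

End Credences.

(* Main.v *)
Require Import Defs.
From mathcomp Require Import all_boot all_order all_algebra.
From mathcomp Require Import all_classical all_reals all_analysis.
From mathcomp Require Import lra.

(** Write [mean v f] for the expectation of [f] under the probability vector
[v]. Given a credence [c] that is not a probability, consider the divergence
[H v = mean v (s c) - mean v (s v)]. Strict propriety says that [H > 0] on the
simplex, and the dominating probability is a minimizer of [H].

Suppose first that [s c] is finite, and let [v] minimize [H]. For an outcome
[i], let [q = (1 - t) v + t e_i] be a small step from [v] towards the vertex
[e_i]. Since [mean v (s v) <= mean v (s q)],
   [H q <= (1 - t) H v + t (s c i - s q i)],
and [H v <= H q] gives [s q i <= s c i - H v] after division by [t]. Letting
[t] tend to [0], continuity yields [s v i <= s c i - H v < s c i]. This is the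
first-order condition at a minimum of [H], obtained without differentiability:
[s v] is a supergradient of the concave function [v |-> mean v (s v)].

A minimizer exists because the simplex is compact and [H] is lower
semicontinuous ([lsc_attains_min]). Continuity of [s] does not give this at
once, as scores of outcomes of probability zero may be infinite. However the
scores of a full-support [q] are finite, propriety bounds
[p |-> mean p (s p)] by the continuous linear function [p |-> mean p (s q)],
and [q] can be taken close enough to [v] for this bound to be almost tight at
[v] ([mean_score_usc]).

When [s c] takes the value [+oo], the argument is carried out on the face of
the simplex spanned by the outcomes with [s c] finite. Its minimizer beats [c]
at these outcomes, hence so do all nearby probability vectors; one with full
support has finite scores, so it also beats [c] where [s c] is infinite
([proper_domination]). *)

Set Implicit Arguments.
Unset Strict Implicit.
Unset Printing Implicit Defensive.

Import Order.TTheory GRing.Theory Num.Theory.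
Import numFieldNormedType.Exports.

Local Open Scope classical_set_scope.
Local Open Scope ring_scope.

(** * Minima of lower semicontinuous functions *)

(** The sets [{x in K | f x <= f y}], for [y] in [K], are totally ordered by
inclusion, so they generate a filter; semicontinuity makes any cluster point
of that filter a minimizer. *)
Lemma lsc_attains_min (R : realType) (T : topologicalType) (K : set T)
    (f : T -> R) :
  K !=set0 -> compact K ->
  (forall x a, K x -> a < f x -> \forall y \near within K (nbhs x), a < f y) ->
  exists2 x, K x & forall y, K y -> f x <= f y.
Proof.
move=> K0 cK lsc; pose B y := [set x | K x /\ f x <= f y].
have FB : Filter (filter_from K B).
  apply: filter_from_filter => // x y Kx Ky.
  have [xy|yx] := leP (f x) (f y).
    by exists x => // z [Kz zx]; split; split => //; exact: le_trans xy.
  exists y => // z [Kz zy]; split; split => //.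
  exact: le_trans zy (ltW yx).
have PB : ProperFilter (filter_from K B).
  by apply: filter_from_proper => y Ky; exists y.
have [|x [Kx clx]] := cK _ PB.
  by case: K0 => x Kx; exists x => // y [].
exists x => // y Ky; rewrite leNgt; apply/negP => fyx.
have By : filter_from K B (B y) by exists y.
have [z [[Kz zy] /(_ Kz) yz]] := clx _ _ By (lsc _ _ Kx fyx).
by move: yz; rewrite ltNge zy.
Qed.

(** * Probability vectors and expectations *)

Section Mean.
Context {R : realType} {n : nat}.
Implicit Types (v w p q : 'rV[R]_n) (f g : 'I_n -> \bar R) (i : 'I_n).

Definition prob_vector : set 'rV[R]_n :=
  [set v | (forall i, 0 <= v 0 i) /\ \sum_i v 0 i = 1].

(** The convention [0 * +oo = 0] makes this sum ignore, as it should, the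
outcomes of probability zero. *)
Definition mean v f : \bar R := (\sum_i (v 0 i)%:E * f i)%E.

Definition mix (t : R) v w := (1 - t) *: v + t *: w.

Lemma mixE t v w i : mix t v w 0 i = (1 - t) * v 0 i + t * w 0 i.
Proof. by rewrite !mxE. Qed.

Lemma mix_prob_vector t v w : 0 <= t <= 1 ->
  prob_vector v -> prob_vector w -> prob_vector (mix t v w).
Proof.
move=> /andP[t0 t1] [v0 v1] [w0 w1]; split=> [i|].
  by rewrite mixE addr_ge0// mulr_ge0// subr_ge0.
under eq_bigr do rewrite mixE.
by rewrite big_split/= -!mulr_sumr v1 w1 !mulr1 subrK.
Qed.

Lemma mean_mix t v w f : 0 <= t <= 1 ->
  (forall i, 0 <= v 0 i) -> (forall i, 0 <= w 0 i) -> (forall i, 0 <= f i)%E ->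
  (mean (mix t v w) f = (1 - t)%:E * mean v f + t%:E * mean w f)%E.
Proof.
move=> /andP[t0 t1] v0 w0 f0; rewrite /mean.
rewrite !ge0_sume_distrr; [|by move=> i _; rewrite mule_ge0// lee_fin..].
rewrite -big_split/=; apply: eq_bigr => i _.
rewrite mixE EFinD ge0_muleDl ?EFinM ?muleA//.
- by rewrite lee_fin mulr_ge0// subr_ge0.
- by rewrite lee_fin mulr_ge0.
Qed.

Lemma delta_prob_vector i : prob_vector (delta_mx 0 i).
Proof.
split=> [j|]; first by rewrite mxE ler0n.
rewrite (bigD1 i)//= big1 => [|j /negPf ji]; last by rewrite !mxE ji.
by rewrite !mxE !eqxx addr0.
Qed.

Lemma mean_delta i f : mean (delta_mx 0 i) f = f i.
Proof.
rewrite /mean (bigD1 i)//= big1 => [|j /negPf ji].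
  by rewrite !mxE !eqxx adde0 mul1e.
by rewrite !mxE ji mul0e.
Qed.

Lemma le_mean v f g : (forall i, 0 <= v 0 i) ->
  (forall i, 0 < v 0 i -> (f i <= g i)%E) -> (mean v f <= mean v g)%E.
Proof.
move=> v0 fg; apply: lee_sum => i _.
have := v0 i; rewrite le_eqVlt => /predU1P[<-|vi]; first by rewrite !mul0e.
by rewrite lee_pmul2l ?fg.
Qed.

Lemma eq_mean v f g : (forall i, v 0 i != 0 -> f i = g i) ->
  mean v f = mean v g.
Proof.
move=> fg; apply: eq_bigr => i _.
by have [->|/fg->//] := eqVneq (v 0 i) 0; rewrite !mul0e.
Qed.

Lemma mean_EFin v (r : 'I_n -> R) :
  mean v (fun i => (r i)%:E) = (\sum_i v 0 i * r i)%:E.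
Proof. by rewrite -sumEFin; apply: eq_bigr => i _; rewrite EFinM. Qed.

Lemma mean_ge0 v f : (forall i, 0 <= v 0 i) -> (forall i, 0 <= f i)%E ->
  (0 <= mean v f)%E.
Proof. by move=> v0 f0; apply: sume_ge0 => i _; rewrite mule_ge0// lee_fin. Qed.

Lemma mean_fin_num v f i : (forall i, 0 <= v 0 i) -> (forall i, 0 <= f i)%E ->
  (mean v f < +oo)%E -> 0 < v 0 i -> f i \is a fin_num.
Proof.
move=> v0 f0 + vi; rewrite ge0_fin_numE//; apply: contraTT; rewrite -!leNgt.
rewrite !leye_eq => /eqP fi; rewrite /mean (bigD1 i)//= fi gt0_muley ?lte_fin//.
rewrite addye// gt_eqF// (lt_le_trans ltNy0)// sume_ge0// => j _.
by rewrite mule_ge0// lee_fin.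
Qed.

Lemma cvg_dot (r : 'I_n -> R) v :
  \sum_i w 0 i * r i @[w --> v] --> \sum_i v 0 i * r i.
Proof.
apply: (cvg_big add_continuous (nbhs_filter v)) => i _.
by apply: cvgM; [exact: coord_continuous|exact: cvg_cst].
Qed.

(** The face is the product of the intervals `[0, 1], for indices in [A], and
`[0, 0], for the others, cut by a closed hyperplane. *)
Lemma prob_face_compact (A : pred 'I_n) :
  compact [set v | prob_vector v /\ forall i, ~~ A i -> v 0 i = 0].
Proof.
pose box := [set v : 'rV[R]_n | forall i, `[0, (A i)%:R]%classic (v ord0 i)].
suff -> : [set v | prob_vector v /\ forall i, ~~ A i -> v 0 i = 0] =
    box `&` (fun v => \sum_i v 0 i * 1) @^-1` [set 1].
  apply: compact_closedI; first 
    by apply: (@rV_compact R n (fun i => `[0, (A i)%:R]%classic)) => i;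
      exact: segment_compact.
  apply: preimage_closed => [v _|]; last exact: closed_eq.
  exact: (@cvg_dot (fun=> 1) v).
have dot1 v : \sum_i v 0 i * 1 = \sum_i v 0 i :> R.
  by under eq_bigr do rewrite mulr1.
apply/seteqP; split=> v /=; rewrite dot1.
  move=> [[v0 v1] vA]; split=> // i; rewrite /= in_itv/= v0/=.
  have [Ai|/vA-> //] := boolP (A i).
  by rewrite -v1 (bigD1 i)//= lerDl sumr_ge0.
move=> [vb v1]; split; first split=> //.
  by move=> i; have := vb i; rewrite /= in_itv/= => /andP[].
move=> i /negPf Ai; have := vb i; rewrite /= in_itv/= Ai => /andP[? ?].
by apply/eqP; rewrite eq_le; apply/andP.
Qed.

(** Continuity of the scores is used below only along segments: whatever holds
around [v] holds a short way from [v] towards any other probability vector. *)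
Lemma near_mix v w (P : set 'rV[R]_n) : prob_vector v -> prob_vector w ->
  (\forall q \near within prob_vector (nbhs v), P q) ->
  exists t, [/\ 0 < t, t <= 1 & P (mix t v w)].
Proof.
move=> vP wP nP.
have cv : mix t v w @[t --> (0 : R)^'+] --> v.
  rewrite -[X in _ --> X](_ : mix 0 v w = v); last first.
    by rewrite /mix subr0 scale1r scale0r addr0.
  apply: (@cvg_at_right_filter R 'rV[R]_n (fun t => mix t v w)).
  exact: (cvgD (cvgZr_tmp (cvgB (cvg_cst _) cvg_id)) (cvgZr_tmp cvg_id)).
have cP : \forall t \near (0 : R)^'+, prob_vector (mix t v w) -> P (mix t v w).
  exact: cv nP.
near (0 : R)^'+ => t.
have t0 : 0 < t by near: t; exact: nbhs_right_gt.
have t1 : t <= 1 by near: t; exact: nbhs_right_le.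
exists t; split=> //.
have : prob_vector (mix t v w) by apply: mix_prob_vector => //; rewrite ltW.
by near: t.
Unshelve. all: by end_near. Qed.

End Mean.

(** * Domination by a proper score *)

Section Domination.
Context {R : realType} {n : nat}.
Implicit Types (v w p q : 'rV[R]_n) (i : 'I_n).
Variables (S : 'rV[R]_n -> 'I_n -> \bar R).
Hypothesis n_gt0 : (0 < n)%N.
Hypothesis S_ge0 : forall v i, (0 <= S v i)%E.
Hypothesis S_proper : forall p q, prob_vector p -> prob_vector q ->
  (mean p (S p) <= mean p (S q))%E.
Hypothesis S_finite : forall p, prob_vector p -> (mean p (S p) < +oo)%E.
Hypothesis S_cont : forall v i, prob_vector v ->
  S q i @[q --> within prob_vector (nbhs v)] --> S v i.

Let full_support (v : 'rV[R]_n) := forall i, 0 < v 0 i.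

Lemma near_score_lt v i (a : \bar R) : prob_vector v -> (S v i < a)%E ->
  \forall q \near within prob_vector (nbhs v), (S q i < a)%E.
Proof. move=> vP /open_ereal_lt'; exact: (S_cont vP). Qed.

Lemma near_score_gt v i (a : \bar R) : prob_vector v -> (a < S v i)%E ->
  \forall q \near within prob_vector (nbhs v), (a < S q i)%E.
Proof. move=> vP /open_ereal_gt'; exact: (S_cont vP). Qed.

(** Step from [v] towards the barycenter. *)
Lemma near_full_support v (P : set 'rV[R]_n) : prob_vector v ->
  (\forall q \near within prob_vector (nbhs v), P q) ->
  exists q, [/\ prob_vector q, full_support q & P q].
Proof.
move=> vP nP; pose u : 'rV[R]_n := const_mx n%:R^-1.
have nR : 0 < n%:R :> R by rewrite ltr0n.
have uP : prob_vector u.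
  split=> [i|]; first by rewrite mxE invr_ge0 ltW.
  under eq_bigr do rewrite mxE.
  by rewrite sumr_const card_ord -[_ *+ _]mulr_natr mulVf ?gt_eqF.
have [t [t0 t1 Pt]] := near_mix vP uP nP.
exists (mix t v u); split=> // [|i].
  by apply: mix_prob_vector => //; rewrite ltW.
rewrite mixE ltr_wpDl// ?mulr_gt0 ?mxE ?invr_gt0//.
by rewrite mulr_ge0 ?subr_ge0//; case: vP.
Qed.

Lemma full_support_fin q i : prob_vector q -> full_support q ->
  S q i \is a fin_num.
Proof.
move=> qP qf; apply: (mean_fin_num (v := q)) => //; first by case: qP.
exact: S_finite.
Qed.

(** Near [v] there is a full-support [q] with [mean v (S q) < a], and
[p |-> mean p (S q)] is a continuous upper bound of [p |-> mean p (S p)]. *)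
Lemma mean_score_usc v (a : R) : prob_vector v -> (mean v (S v) < a%:E)%E ->
  \forall p \near within prob_vector (nbhs v), (mean p (S p) < a%:E)%E.
Proof.
move=> vP va; have [v0 v1] := vP.
have Sv i : 0 < v 0 i -> S v i \is a fin_num.
  by move=> vi; apply: mean_fin_num vi => //; exact: S_finite.
pose g := fine (mean v (S v)).
have gE : mean v (S v) = g%:E.
  by rewrite fineK// ge0_fin_numE ?S_finite// mean_ge0.
have ga : g < a by rewrite -lte_fin -gE.
pose e := (a - g) / 2.
have e0 : 0 < e by rewrite divr_gt0// subr_gt0.
(* Only where [v] is positive is [S v i] known to be finite; the other outcomes
   do not contribute to [mean v (S q)]. *)
have : \forall q \near within prob_vector (nbhs v),
    forall i, 0 < v 0 i -> (S q i <= S v i + e%:E)%E.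
  apply: filter_forall => i.
  have [vi|vi] := ltP 0 (v 0 i); last by apply: nearW.
  have : (S v i < S v i + e%:E)%E by rewrite lteDl ?Sv// lte_fin.
  by move=> /(near_score_lt vP); apply: filterS => q qi _; exact: ltW.
move=> /(near_full_support vP)[q [qP qf qv]].
pose r i := fine (S q i).
have rE i : S q i = (r i)%:E by rewrite fineK// full_support_fin.
have mE p : mean p (S q) = (\sum_i p 0 i * r i)%:E.
  by rewrite -mean_EFin; apply: eq_mean => i _.
have va' : \sum_i v 0 i * r i < a.
  rewrite -lte_fin -mE; apply: (@le_lt_trans _ _ (g + e)%:E); last first.
    by rewrite lte_fin /e; lra.
  rewrite (_ : (g + e)%:E = mean v (fun i => (fine (S v i) + e)%:E)).
    apply: le_mean => // i vi; rewrite EFinD fineK ?Sv//; exact: qv.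
  rewrite mean_EFin; congr EFin.
  under eq_bigr do rewrite mulrDr.
  rewrite big_split/= -mulr_suml v1 mul1r; congr (_ + _).
  apply: EFin_inj; rewrite -gE -mean_EFin; apply: eq_mean => i vi.
  by rewrite fineK// Sv// lt_neqAle eq_sym vi v0.
have near_a : \forall p \near nbhs v, \sum_i (p : 'rV[R]_n) 0 i * r i < a.
  exact: cvg_dot (lt_nbhsl va').
rewrite near_withinE; apply: filterS near_a => p pa pP.
by rewrite (le_lt_trans (S_proper pP qP))// mE lte_fin.
Qed.

(** Minimize the divergence of [C] from the scores over the face where [C] is
finite, then move the minimizer to a nearby point of full support. *)
Theorem proper_domination (C : 'I_n -> \bar R) :
  (forall i, 0 <= C i)%E ->
  (forall p, prob_vector p -> mean p (S p) < mean p C)%E ->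
  exists2 p, prob_vector p & forall i, (S p i < C i)%E.
Proof.
move=> C0 SC; pose A : pred 'I_n := fun i => C i \is a fin_num.
(* It suffices to beat [C] where it is finite: a full-support perturbation
   keeps these strict inequalities and has finite scores. *)
suff [v vP vA] : exists2 v, prob_vector v & forall i, A i -> (S v i < C i)%E.
  have : \forall q \near within prob_vector (nbhs v),
      forall i, A i -> (S q i < C i)%E.
    apply: filter_forall => i.
    have [Ai|_] := boolP (A i); last by apply: nearW.
    by apply: filterS (near_score_lt vP (vA i Ai)).
  move=> /(near_full_support vP)[q [qP qf qA]]; exists q => // i.
  have [/qA//|] := boolP (A i).
  rewrite /A ge0_fin_numE// -leNgt leye_eq => /eqP ->.
  by rewrite ltey_eq full_support_fin.
have [A0|[i0 Ai0]] : (forall i, ~~ A i) \/ exists i, A i.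
- have [/existsP|/existsPn] := boolP [exists i, A i]; [by right|by left].
- exists (delta_mx 0 (Ordinal n_gt0)); first exact: delta_prob_vector.
  by move=> i; rewrite (negPf (A0 i)).
pose K := [set v : 'rV[R]_n | prob_vector v /\ forall i, ~~ A i -> v 0 i = 0].
pose c i := fine (C i).
pose G v := fine (mean v (S v)).
have GE v : prob_vector v -> mean v (S v) = (G v)%:E.
  move=> vP; rewrite fineK// ge0_fin_numE ?S_finite// mean_ge0//.
  by case: vP.
have CE v : K v -> mean v C = (\sum_i v 0 i * c i)%:E.
  move=> [vP vA]; rewrite -mean_EFin; apply: eq_mean => i vi.
  rewrite fineK//; apply: contraNT vi => /vA ->; exact: eqxx.
pose H v := \sum_i v 0 i * c i - G v.
have H_gt0 v : K v -> 0 < H v.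
  move=> Kv; have [vP _] := Kv.
  by rewrite subr_gt0 -lte_fin -GE// -CE//; exact: SC.
have K_delta i : A i -> K (delta_mx 0 i).
  move=> Ai; split; first exact: delta_prob_vector.
  move=> j Aj; rewrite mxE eqxx/=; case: eqP => // ji.
  by rewrite -ji (negPf Aj) in Ai.
have [v Kv Hv] : exists2 v, K v & forall w, K w -> H v <= H w.
  apply: lsc_attains_min.
  - by exists (delta_mx 0 i0); exact: K_delta.
  - exact: prob_face_compact.
  - move=> v a Kv; rewrite /H => aH; have [vP _] := Kv.
    pose e := (H v - a) / 2; have e0 : 0 < e by rewrite /e /H; lra.
    have /(mean_score_usc vP) nG : (mean v (S v) < (G v + e)%:E)%E.
      by rewrite GE// lte_fin; lra.
    have lc : \sum_i v 0 i * c i - e < \sum_i v 0 i * c i by lra.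
    have nc : \forall w \near nbhs v,
        \sum_i v 0 i * c i - e < \sum_i (w : 'rV[R]_n) 0 i * c i.
      exact: cvg_dot (lt_nbhsr lc).
    rewrite near_withinE; near=> w => Kw; have [wP _] := Kw.
    have : \sum_i v 0 i * c i - e < \sum_i w 0 i * c i.
      by near: w.
    have : (mean w (S w) < (G v + e)%:E)%E by move: wP; near: w.
    by rewrite GE// lte_fin /e /H; lra.
exists v; first by case: Kv.
move=> i Ai; have [vP vA] := Kv; have [v0 v1] := vP.
have Ci : C i = (c i)%:E by rewrite fineK.
(* First-order condition at [v] in the direction of the vertex [i]; a strict
   violation would persist at some point [q] of the segment close to [v]. *)
apply: (@le_lt_trans _ _ (c i - H v)%:E); last first.
  by rewrite Ci lte_fin gtrBl H_gt0.
rewrite leNgt; apply/negP => /(near_score_gt vP).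
have [dP dA] := K_delta i Ai; have [d0 d1] := dP.
move=> /(near_mix vP dP)[t [t0 t1]]; apply/negP; rewrite -leNgt.
set q := mix _ _ _.
have t01 : 0 <= t <= 1 by rewrite ltW.
have qP : prob_vector q by exact: mix_prob_vector.
have [q0 q1] := qP.
have Kq : K q by split=> // j Aj; rewrite mixE vA// dA// !mulr0 addr0.
have qi : 0 < q 0 i.
  rewrite mixE mxE !eqxx mulr1 ltr_wpDl// mulr_ge0// subr_ge0//.
have Sq : S q i \is a fin_num by apply: mean_fin_num qi => //; exact: S_finite.
have : (mean q (S q) >= (1 - t)%:E * mean v (S v) + t%:E * S q i)%E.
  rewrite [leRHS]mean_mix// mean_delta leeD2r//.
  by rewrite lee_wpmul2l ?S_proper// lee_fin subr_ge0.
have cq : \sum_j q 0 j * c j = (1 - t) * (\sum_j v 0 j * c j) + t * c i.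
  apply: EFin_inj; rewrite -CE// mean_mix// mean_delta CE// Ci.
  by rewrite -!EFinM -EFinD.
rewrite !GE// -(fineK Sq) -!EFinM -EFinD !lee_fin.
have := Hv q Kq; rewrite /H cq => Hvq Gq.
by rewrite -(ler_pM2l t0); nra.
Unshelve. all: by end_near. Qed.

End Domination.

(** * Scoring rules on credences *)

Lemma expect_prob_of (R : realType) (Omega : finType) (v : 'rV[R]_#|Omega|)
    (f : Omega -> \bar R) :
  expect (prob_of v) f = mean v (fun i => f (enum_val i)).
Proof.
rewrite /expect /mean big_mkcond (reindex (fun i : 'I_#|Omega| => enum_val i)).
  apply: eq_bigr => i _; rewrite /prob_of big_set1 enum_valK.
  by case: eqP => // ->; rewrite mul0e.
exact/onW_bij/enum_val_bij.
Qed.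

Theorem corollary1 (R : realType) (Omega : finType)
    (s : credence R Omega -> Omega -> \bar R) :
  (0 < #|Omega|)%N ->
  is_scoring_rule s ->
  strictly_proper s ->
  continuous_on_probabilities s ->
  forall c : credence R Omega, ~ is_probability c ->
  exists p : credence R Omega,
    is_probability p /\ forall w : Omega, (s p w < s c w)%E.
Proof.
move=> O_gt0 s0 sP sC c cNP.
have probP v : prob_vector v -> is_probability (prob_of v : credence R Omega).
  by move=> vP; have [_ /(_ erefl)[]] := prob_ofP (prob_of v) vP.
have lt_c v : prob_vector v -> (expect (prob_of v) (s (prob_of v)) <
    expect (prob_of v) (s c))%E.
  by move=> /probP vP; apply: sP => // cv; apply: cNP; rewrite cv.
have [||||||p pP pc] := @proper_domination R _
    (fun v i => s (prob_of v) (enum_val i)) O_gt0 _ _ _ _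
    (fun i => s c (enum_val i)).
- by move=> v i; exact: s0.
- move=> p q /probP pP _; rewrite -!expect_prob_of.
  by have [->//|/eqP qp] := eqVneq (prob_of q) (prob_of p); rewrite ltW ?sP.
(* The competitor [c] itself bounds the expected score of [p] strictly. *)
- move=> p /lt_c; rewrite -expect_prob_of => /lt_le_trans; apply.
  exact: leey.
- move=> v i vP; have /subspace_continuousP/(_ v vP) := sC.
  by move=> /(cvg_comp _ _)/(_ (@proj_continuous _ _ (enum_val i) _)).
- by move=> i; exact: s0.
- by move=> p /lt_c; rewrite !expect_prob_of.
- exists (prob_of p); split; first exact: probP.
  by move=> w; rewrite -(enum_rankK w).
Qed.
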